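(* Let $X,Y\in\mathcal L^2$ and $r=\mathrm{Corr}(X,Y)$. Assume one of the following: (i) $r=0$; (ii) $X$ and $Y$ have identical distributions; (iii) $X$ and $Y$ have different distributions and $|\mathrm{Supp}(Y)|>2$. Then $(X,Y)\in\mathrm{IC}_r$ if and only if $(X,Y)\in\mathrm{IC}^{\uparrow}_r$. Moreover, if (iii) holds and $(X,Y)\in\mathrm{IC}^{\uparrow}_r$, then $r=0$.
   Context: All random variables live on an atomless probability space. $\mathcal L^2$ denotes the set of non-degenerate real random variables with finite variance. A function $g:\mathbb R\to\mathbb R$ is admissible for $(X,Y)$ if it is measurable and $g(X),g(Y)\in\mathcal L^2$. $(X,Y)\in\mathrm{IC}_r$ means $\mathrm{Corr}(X,Y)=\mathrm{Corr}(g(X),g(Y))=r$ for all admissible $g$; $(X,Y)\in\mathrm{IC}^{\uparrow}_r$ means $\mathrm{Corr}(X,Y)=\mathrm{Corr}(g(X),g(Y))=r$ for all admissible increasing (non-strictly) $g$. $\mathrm{Supp}(Y)=\{x:\mathbb P(x-\epsilon<Y\le x+\epsilon)>0\ \forall\epsilon>0\}$. *)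

(* Defs.v *)
From mathcomp Require Import all_boot all_order all_algebra.
From mathcomp Require Import all_classical all_reals all_analysis.
Set Implicit Arguments. Unset Strict Implicit. Unset Printing Implicit Defensive.
Import Order.TTheory GRing.Theory Num.Theory.
Local Open Scope classical_set_scope.
Local Open Scope ring_scope.

Section defs.
Context {d : measure_display} {T : measurableType d} {R : realType}.
Variable P : probability T R.

Definition atomless : Prop :=
  forall A : set T, measurable A -> (0 < P A)%E ->
    exists B : set T, [/\ measurable B, B `<=` A, (0 < P B)%E & (P B < P A)%E].

Definition inL2 (X : T -> R) : Prop :=
  X \in Lfun P 2%:E /\ ~ (exists c : R, {ae P, forall t, X t = c}).

Definition corr (X Y : T -> R) : R :=
  fine (covariance P X Y) /
    (Num.sqrt (fine 'V_P[X]) * Num.sqrt (fine 'V_P[Y])).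

Definition admissible (X Y : T -> R) (g : R -> R) : Prop :=
  [/\ measurable_fun setT g, inL2 (g \o X) & inL2 (g \o Y)].

Definition IC (X Y : T -> R) (r : R) : Prop :=
  corr X Y = r /\
  forall g : R -> R, admissible X Y g -> corr (g \o X) (g \o Y) = r.

Definition IC_up (X Y : T -> R) (r : R) : Prop :=
  corr X Y = r /\
  forall g : R -> R, {homo g : x y / x <= y} ->
    admissible X Y g -> corr (g \o X) (g \o Y) = r.

Definition Supp (Y : T -> R) : set R :=
  [set x | forall e : R, 0 < e -> (0 < P [set t | (x - e < Y t <= x + e)%R])%E].

Definition same_distribution (X Y : T -> R) : Prop :=
  forall A : set R, measurable A -> P (X @^-1` A) = P (Y @^-1` A).

Definition card_gt2 (S : set R) : Prop :=
  exists a b c, [/\ S a, S b, S c & [/\ a != b, a != c & b != c]].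
End defs.

(* Main.v *)
Require Import Defs.
From mathcomp Require Import all_boot all_order all_algebra.
From mathcomp Require Import all_classical all_reals all_analysis.
From mathcomp Require Import measurable_realfun ring lra.
Set Implicit Arguments. Unset Strict Implicit. Unset Printing Implicit Defensive.
Import Order.TTheory GRing.Theory Num.Theory.
Local Open Scope classical_set_scope.
Local Open Scope ring_scope.

(* Bilinearity is exploited along the cone of increasing functions. If [r = 0]
   or the laws agree, the condition on an increasing [g] is the vanishing of the
   quadratic form [Cov(g(X), g(Y)) - r Var(g(X))]; polarising it on sums of two
   indicators of upward closed sets gives an equality of two measures on the
   plane, against which [g x * g y] can be integrated for every measurable [g].
   If [r <> 0], the condition on [f + t h], for increasing [f], [h] and [t > 0],
   says that the product of the quadratics [Var((f + t h)(X))] and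
   [Var((f + t h)(Y))] in [t] is a square. When the second one has no real root
   the two must be proportional, and for indicators of two rays this forces
   equal tails; three points in the support of [Y] then force equal laws. *)

(** * Covariance as a real number, for square-integrable variables *)

Section covariance_real.
Context d (T : measurableType d) (R : realType) (P : probability T R).
Implicit Types U V W : T -> R.

Definition rcov U V : R := fine (covariance P U V).

Let PTfin : P setT \is a fin_num.
Proof. exact: fin_num_measure. Qed.

Lemma Lfun2_1 U : U \in Lfun P 2%:E -> U \in Lfun P 1.
Proof. exact: Lfun_subset12. Qed.

Lemma Lfun2_measurable U : U \in Lfun P 2%:E -> measurable_fun setT U.
Proof. by rewrite inE => /andP[]; rewrite inE. Qed.

Lemma Lfun2D U V : U \in Lfun P 2%:E -> V \in Lfun P 2%:E ->
  U \+ V \in Lfun P 2%:E.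
Proof. by move=> U2 V2; rewrite rpredD ?lee1n. Qed.

Lemma Lfun2Z (t : R) U : U \in Lfun P 2%:E -> t \o* U \in Lfun P 2%:E.
Proof. by move=> U2; rewrite Lfun_scale// ler1n. Qed.

Lemma Lfun2_norm U : U \in Lfun P 2%:E -> Num.norm \o U \in Lfun P 2%:E.
Proof.
move=> U2; rewrite inE; apply/andP; split; rewrite inE/=.
  by apply: measurableT_comp => //; exact: Lfun2_measurable.
move: U2; rewrite inE => /andP[_]; rewrite inE/= /finite_norm.
by rewrite -[in X in X -> _]Lnorm_abse.
Qed.

Lemma Lfun2_indic (A : set T) : measurable A ->
  (\1_A : T -> R) \in Lfun P 2%:E.
Proof.
move=> mA; rewrite inE; apply/andP; split; rewrite inE//=.
rewrite /finite_norm unlock poweR_lty//.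
rewrite (eq_integral (fun x => (\1_A x)%:E)) => [|x _]; last first.
  rewrite -[LHS]/((`|\1_A x : R| `^ 2)%:E) !indicE.
  by case: (x \in A); rewrite ?normr1 ?powR1// normr0 powR0.
by rewrite integral_indic// setIT (le_lt_trans (probability_le1 _ mA))// ltry.
Qed.

Lemma rcov_fin U V : U \in Lfun P 2%:E -> V \in Lfun P 2%:E ->
  covariance P U V \is a fin_num.
Proof.
move=> U2 V2; apply: covariance_fin_num; try exact: Lfun2_1.
exact: Lfun2_mul_Lfun1.
Qed.

Lemma rcovC U V : rcov U V = rcov V U.
Proof. by rewrite /rcov covarianceC. Qed.

Lemma rcovE U V : U \in Lfun P 2%:E -> V \in Lfun P 2%:E ->
  rcov U V = fine 'E_P[U \* V] - fine 'E_P[U] * fine 'E_P[V].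
Proof.
move=> U2 V2; have UV := Lfun2_mul_Lfun1 U2 V2.
have [U1 V1] := (Lfun2_1 U2, Lfun2_1 V2).
by rewrite /rcov covarianceE// fineB ?fin_numM ?expectation_fin_num// fineM
  ?expectation_fin_num.
Qed.

Lemma rcovDl U V W : U \in Lfun P 2%:E -> V \in Lfun P 2%:E ->
  W \in Lfun P 2%:E -> rcov (U \+ V) W = rcov U W + rcov V W.
Proof. by move=> U2 V2 W2; rewrite /rcov covarianceDl// fineD ?rcov_fin. Qed.

Lemma rcovZl (t : R) U V : U \in Lfun P 2%:E -> V \in Lfun P 2%:E ->
  rcov (t \o* U) V = t * rcov U V.
Proof.
move=> U2 V2; have UV := Lfun2_mul_Lfun1 U2 V2.
rewrite /rcov (covarianceZl t (Lfun2_1 U2) (Lfun2_1 V2) UV).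
by rewrite fineM ?rcov_fin.
Qed.

(** With [t] free this supplies the quadratics compared by [square_eq_mul_quadratic]; with [t = 1]
    it polarises a quadratic form. *)
Lemma rcovDZ (t : R) U V U' V' :
  U \in Lfun P 2%:E -> V \in Lfun P 2%:E ->
  U' \in Lfun P 2%:E -> V' \in Lfun P 2%:E ->
  rcov (U \+ t \o* V) (U' \+ t \o* V') =
  rcov U U' + t * (rcov U V' + rcov V U') + t ^+ 2 * rcov V V'.
Proof.
move=> U2 V2 U'2 V'2.
rewrite rcovDl ?Lfun2Z ?Lfun2D ?Lfun2Z// rcovZl ?Lfun2D ?Lfun2Z//.
rewrite ![rcov _ (_ \+ _)]rcovC !rcovDl ?Lfun2Z// !rcovZl//.
by rewrite ![rcov _ U]rcovC ![rcov _ V]rcovC; ring.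
Qed.

Lemma rcov_ge0 U : 0 <= rcov U U.
Proof. by rewrite fine_ge0// variance_ge0. Qed.

(** The variance integrates the square of the centred variable [W], and a nonnegative function with
    zero integral vanishes almost everywhere. *)
Lemma rcov_ae_cst0 U : U \in Lfun P 2%:E -> rcov U U = 0 ->
  exists c : R, {ae P, forall t, U t = c}.
Proof.
move=> U2 V0; exists (fine 'E_P[U]).
have cov0 : covariance P U U = 0%E.
  by rewrite -(fineK (rcov_fin U2 U2)) -/(rcov U U) V0.
pose W := U \- cst (fine 'E_P[U]).
have mW : measurable_fun setT W.
  by apply: measurable_funB => //; exact: Lfun2_measurable.
have EW0 : ('E_P[(W * W)%R] = 0)%E by rewrite -cov0 [in RHS]unlock.
rewrite unlock in EW0.
have : ae_eq P setT (EFin \o (W * W)) (cst 0%E).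
  apply/ae_eq_integral_abs => //.
    by apply/measurable_EFinP; exact: measurable_funM.
  rewrite -[RHS]EW0; apply: eq_integral => x _.
  by rewrite gee0_abs// lee_fin; exact: sqr_ge0.
apply: filterS => t /(_ I)/= [] /eqP.
by rewrite -[(W * W) t]/(W t * W t) mulf_eq0 orbb subr_eq0 => /eqP.
Qed.

Lemma ae_cst_rcov0 U (c : R) : U \in Lfun P 2%:E -> {ae P, forall t, U t = c} ->
  rcov U U = 0.
Proof.
move=> U2 Uc.
have mU := Lfun2_measurable U2.
have E (f : R -> R) : measurable_fun setT f -> ('E_P[f \o U] = (f c)%:E)%E.
  move=> mf; rewrite -[RHS](expectation_cst P) unlock.
  apply: ae_eq_integral => //.
  - by apply/measurable_EFinP; exact: measurableT_comp.
  - by apply/measurable_EFinP; exact: measurable_cst.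
  - by apply: filterS Uc => t /= ->.
rewrite rcovE// (E id)//= (_ : U \* U = (fun x => x * x) \o U)// E/= ?subrr//.
exact: measurable_funM.
Qed.

(** The Cauchy-Schwarz bound [covariance_le] is one-sided, so it is applied both to [U] and to its
    opposite. *)
Lemma rcov_eq0l U V : U \in Lfun P 2%:E -> V \in Lfun P 2%:E ->
  rcov U U = 0 -> rcov U V = 0.
Proof.
move=> U2 V2 V0.
have le0 W : W \in Lfun P 2%:E -> rcov W W = 0 -> rcov W V <= 0.
  move=> W2 W0; have := covariance_le W2 V2.
  have -> : 'V_P[W] = 0%E.
    by rewrite /variance -(fineK (rcov_fin W2 W2)) -/(rcov W W) W0.
  by rewrite sqrte0 mul0e -(fineK (rcov_fin W2 V2)) lee_fin.
apply/eqP; rewrite eq_le le0//= -oppr_le0 -mulN1r -rcovZl// le0 ?Lfun2Z//.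
by rewrite rcovZl ?Lfun2Z// rcovC rcovZl// V0 !mulr0.
Qed.

Lemma inL2P U : inL2 P U <-> U \in Lfun P 2%:E /\ rcov U U != 0.
Proof.
split=> -[U2 Uc]; split=> //.
  by apply/eqP => /(rcov_ae_cst0 U2).
by move=> [c /(ae_cst_rcov0 U2)/eqP]; exact/negP.
Qed.

Lemma corrE U V : corr P U V =
  rcov U V / (Num.sqrt (rcov U U) * Num.sqrt (rcov V V)).
Proof. by []. Qed.

End covariance_real.

(** * Polynomial identities that force proportionality *)

Section quadratics.
Variable F : realFieldType.

(** Evaluation at the five positive points 1 to 5 gives an invertible Vandermonde system. *)
Lemma quartic_eq0 (c0 c1 c2 c3 c4 : F) :
  (forall t, 0 < t -> c0 + c1 * t + c2 * t ^+ 2 + c3 * t ^+ 3 + c4 * t ^+ 4 = 0) ->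
  [/\ c0 = 0, c1 = 0, c2 = 0, c3 = 0 & c4 = 0].
Proof.
move=> c_eq0.
have := c_eq0 1 ltac:(lra); have := c_eq0 2 ltac:(lra).
have := c_eq0 3 ltac:(lra); have := c_eq0 4 ltac:(lra).
have := c_eq0 5 ltac:(lra).
by rewrite !exprS !expr0 !mulr1 => e1 e2 e3 e4 e5; split; lra.
Qed.

(* As [b] has no real root, [p ^ 2 = a * b] forces [b] to divide [p]: writing
   [p = c * b + l] with [l] affine, [b] times a polynomial of degree at most
   two equals [l ^ 2], which has a vanishing discriminant, so that [l = 0]. *)
Lemma square_eq_mul_quadratic (p0 p1 p2 a0 a1 a2 b0 b1 b2 : F) :
  (forall t, 0 < t -> (p0 + t * p1 + t ^+ 2 * p2) ^+ 2 =
    (a0 + t * a1 + t ^+ 2 * a2) * (b0 + t * b1 + t ^+ 2 * b2)) ->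
  b1 ^+ 2 < 4 * b0 * b2 ->
  exists k, [/\ a0 = k * b0, a1 = k * b1 & a2 = k * b2].
Proof.
move=> pab disc.
have [] : [/\ p0 ^+ 2 - a0 * b0 = 0,
    2 * p0 * p1 - a0 * b1 - a1 * b0 = 0,
    p1 ^+ 2 + 2 * p0 * p2 - a0 * b2 - a1 * b1 - a2 * b0 = 0,
    2 * p1 * p2 - a1 * b2 - a2 * b1 = 0 & p2 ^+ 2 - a2 * b2 = 0].
  apply: quartic_eq0 => t /pab/eqP.
  by rewrite -subr_eq0 => /eqP pabt; rewrite -[RHS]pabt; ring.
have b2_neq0 : b2 != 0.
  by apply/eqP => b20; move: disc; rewrite b20 mulr0 ltNge sqr_ge0.
have [c [l0 [l1 [-> -> ->]]]] : exists c l0 l1,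
    [/\ p0 = c * b0 + l0, p1 = c * b1 + l1 & p2 = c * b2].
  exists (p2 / b2), (p0 - p2 / b2 * b0), (p1 - p2 / b2 * b1).
  by rewrite divfK// ![_ + (_ - _)]addrC !subrK.
move=> e0 e1 e2 e3 e4.
(* The coefficients of degree four and three leave [a = c ^ 2 * b + 2 * c * l + a0'] with [a0']
   constant; the three lower ones then read [l ^ 2 = a0' * b]. *)
pose a0' := a0 - c ^+ 2 * b0 - 2 * c * l0.
have a2E : a2 = c ^+ 2 * b2.
  by apply: (mulIf b2_neq0); apply/eqP;
    rewrite -subr_eq0 -oppr_eq0 -e4; apply/eqP; ring.
have a1E : a1 = c ^+ 2 * b1 + 2 * c * l1.
  apply: (mulIf b2_neq0); apply/eqP; rewrite -subr_eq0 -oppr_eq0 -e3 a2E.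
  by apply/eqP; ring.
have f0 : l0 ^+ 2 = a0' * b0.
  by apply/eqP; rewrite -subr_eq0 -e0 /a0'; apply/eqP; ring.
have f1 : 2 * l0 * l1 = a0' * b1.
  by apply/eqP; rewrite -subr_eq0 -e1 /a0' a1E; apply/eqP; ring.
have f2 : l1 ^+ 2 = a0' * b2.
  by apply/eqP; rewrite -subr_eq0 -e2 /a0' a1E a2E; apply/eqP; ring.
have a0'0 : a0' = 0.
  have : a0' ^+ 2 * (4 * b0 * b2 - b1 ^+ 2) = 0.
    transitivity (4 * (a0' * b0) * (a0' * b2) - (a0' * b1) ^+ 2); first by ring.
    by rewrite -f0 -f1 -f2; ring.
  move/eqP; rewrite mulf_eq0 [X in _ || X]gt_eqF ?subr_gt0// orbF.
  by rewrite expf_eq0 => /eqP.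
have l00 : l0 = 0 by apply/eqP; rewrite -sqrf_eq0 f0 a0'0 mul0r.
have l10 : l1 = 0 by apply/eqP; rewrite -sqrf_eq0 f2 a0'0 mul0r.
exists (c ^+ 2); split=> //; last by rewrite a1E l10 mulr0 addr0.
by apply/eqP; rewrite -subr_eq0 -a0'0 /a0' l00; apply/eqP; ring.
Qed.

(* [p], [p'] and [q], [q'] stand for the tails at two thresholds of two
   distributions whose indicators have proportional covariance matrices. *)
Lemma proportional_bernoulli_cov (k p p' q q' : F) :
  p * (1 - p) = k * (q * (1 - q)) ->
  p' * (1 - p) = k * (q' * (1 - q)) ->
  p' * (1 - p') = k * (q' * (1 - q')) ->
  k != 0 -> 0 < q' -> q' < q -> q < 1 -> p = q /\ p' = q'.
Proof.
move=> e0 e1 e2 k0 q'0 q'q q1.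
have q10 : 1 - q != 0 by lra.
have p'0 : p' != 0.
  apply/eqP => p'0; move/eqP: e1; rewrite p'0 mul0r eq_sym mulf_eq0 (negbTE k0) /=.
  by rewrite mulf_eq0 (negbTE q10) gt_eqF.
have p10 : 1 - p != 0.
  apply/eqP => p10; move/eqP: e1; rewrite p10 mulr0 eq_sym mulf_eq0 (negbTE k0) /=.
  by rewrite mulf_eq0 (negbTE q10) gt_eqF.
(* Dividing the first equation by the second gives [p / p' = q / q'], and the second by the third
   [(1 - p) / (1 - p') = (1 - q) / (1 - q')]. These two relations determine [p] and [p']. *)
have h1 : p * q' = p' * q.
  apply: (mulIf p10); apply: (mulIf p'0); apply: (mulIf k0); apply: (mulIf q10).
  transitivity ((p * (1 - p)) * p' * (k * (q' * (1 - q)))); first by ring.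
  by rewrite e0 -e1; ring.
have h2 : (1 - p) * (1 - q') = (1 - p') * (1 - q).
  apply: (mulfI p'0); apply: (mulfI k0).
  have q'n : q' != 0 by rewrite gt_eqF.
  apply: (mulfI q'n).
  transitivity ((p' * (1 - p)) * (k * (q' * (1 - q')))); first by ring.
  by rewrite -e2 e1; ring.
have : p' * (q - q') = q' * (q - q').
  transitivity (p' * q - q' * p'); first by ring.
  rewrite -h1; nra.
have qq' : q - q' != 0 by lra.
move=> /(mulIf qq') p'E; split=> //.
move: h1; rewrite p'E mulrC => /mulfI; apply; exact: lt0r_neq0.
Qed.

End quadratics.

(** * Indicators of open rays and their covariances *)

Section rays.
Context d (T : measurableType d) (R : realType) (P : probability T R).
Implicit Types (U X Y : T -> R) (a b : R).

Definition ray b : R -> R := \1_`]b, +oo[%classic.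

Definition tail U b : R := fine (P (U @^-1` `]b, +oo[%classic)).

Lemma rayE b x : ray b x = (b < x)%R%:R.
Proof. by rewrite /ray indicE mem_setE in_itv/= andbT. Qed.

Lemma homo_ray b : {homo ray b : x y / x <= y}.
Proof.
by move=> x y xy; rewrite !rayE ler_nat; case: ltP => // bx;
  rewrite (lt_le_trans bx xy).
Qed.

Lemma ray_comp U b : ray b \o U = \1_(U @^-1` `]b, +oo[%classic).
Proof. by apply/funext => t; rewrite /= /ray !indicE. Qed.

Lemma measurable_ray b : measurable_fun setT (ray b).
Proof. exact: measurable_indic. Qed.

Lemma measurable_tail U b : measurable_fun setT U ->
  measurable (U @^-1` `]b, +oo[%classic).
Proof. by move=> mU; rewrite -[X in measurable X]setTI; exact: mU. Qed.

Lemma Lfun2_ray U b : measurable_fun setT U -> ray b \o U \in Lfun P 2%:E.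
Proof. by move=> mU; rewrite ray_comp Lfun2_indic//; exact: measurable_tail. Qed.

Lemma expectation_ray U b : measurable_fun setT U ->
  fine 'E_P[ray b \o U] = tail U b.
Proof. by move=> mU; rewrite ray_comp expectation_indic//; exact: measurable_tail. Qed.

Lemma le_tail U a b : measurable_fun setT U -> a <= b -> tail U b <= tail U a.
Proof.
move=> mU ab; rewrite fine_le ?fin_num_measure//; try exact: measurable_tail.
rewrite le_measure ?inE//; try exact: measurable_tail.
by move=> t /=; rewrite !in_itv/= !andbT; exact: le_lt_trans.
Qed.

Lemma tail_ge0 U b : 0 <= tail U b.
Proof. exact: fine_ge0. Qed.

Lemma tail_le1 U b : measurable_fun setT U -> tail U b <= 1.
Proof.
move=> mU; rewrite -lee_fin fineK ?fin_num_measure//; last exact: measurable_tail.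
by rewrite probability_le1//; exact: measurable_tail.
Qed.

(** The rays are nested, so the product of their indicators is the indicator of the smaller one. *)
Lemma rcov_ray U a b : measurable_fun setT U -> a <= b ->
  rcov P (ray a \o U) (ray b \o U) = tail U b * (1 - tail U a).
Proof.
move=> mU ab; rewrite rcovE; try exact: Lfun2_ray.
rewrite (_ : (ray a \o U) \* (ray b \o U) = ray b \o U); last first.
  apply/funext => t; rewrite /= !rayE -natrM mulnb; congr (nat_of_bool _)%:R.
  by apply: andb_idl; exact: le_lt_trans.
by rewrite !expectation_ray//; ring.
Qed.

End rays.

(** * The correlation condition along increasing functions *)

Section increasing.
Context d (T : measurableType d) (R : realType) (P : probability T R).
Implicit Types (X Y : T -> R) (f g h : R -> R).

(** Clearing denominators extends the condition to degenerate [g(X)] or [g(Y)], where both sides are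
    zero. Sums and indicators can then be tested without checking admissibility. *)
Lemma IC_up_rcov X Y (r : R) g : IC_up P X Y r -> {homo g : x y / x <= y} ->
  measurable_fun setT g -> g \o X \in Lfun P 2%:E -> g \o Y \in Lfun P 2%:E ->
  rcov P (g \o X) (g \o Y) =
  r * (Num.sqrt (rcov P (g \o X) (g \o X)) * Num.sqrt (rcov P (g \o Y) (g \o Y))).
Proof.
move=> [_ +] g_incr mg gX gY => /(_ g g_incr).
have [VX0 _|VX0] := eqVneq (rcov P (g \o X) (g \o X)) 0.
  by rewrite rcov_eq0l// VX0 sqrtr0 mul0r mulr0.
have [VY0 _|VY0] := eqVneq (rcov P (g \o Y) (g \o Y)) 0.
  by rewrite rcovC rcov_eq0l// VY0 sqrtr0 !mulr0.
move=> corrg; rewrite -corrg; last by split => //; apply/inL2P.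
by rewrite corrE divfK// mulf_neq0// sqrtr_eq0 -ltNge lt0r rcov_ge0 andbT.
Qed.

Lemma IC_upC X Y (r : R) : IC_up P X Y r -> IC_up P Y X r.
Proof.
have corrC U V : corr P U V = corr P V U.
  by rewrite !corrE rcovC [X in _ / X]mulrC.
move=> [XY XYg]; split=> [|g g_incr [mg gY gX]]; rewrite corrC//.
by apply: XYg.
Qed.

(** The last hypothesis, strict Cauchy-Schwarz, says that the variance of [(f + t h)(Y)] has
    negative discriminant as a quadratic in [t]. *)
Lemma IC_up_proportional X Y (r : R) f h : IC_up P X Y r -> r != 0 ->
  {homo f : x y / x <= y} -> {homo h : x y / x <= y} ->
  measurable_fun setT f -> measurable_fun setT h ->
  f \o X \in Lfun P 2%:E -> f \o Y \in Lfun P 2%:E ->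
  h \o X \in Lfun P 2%:E -> h \o Y \in Lfun P 2%:E ->
  rcov P (f \o Y) (h \o Y) ^+ 2 <
    rcov P (f \o Y) (f \o Y) * rcov P (h \o Y) (h \o Y) ->
  exists k, [/\ rcov P (f \o X) (f \o X) = k * rcov P (f \o Y) (f \o Y),
    rcov P (f \o X) (h \o X) = k * rcov P (f \o Y) (h \o Y) &
    rcov P (h \o X) (h \o X) = k * rcov P (h \o Y) (h \o Y)].
Proof.
move=> XYr r0 f_incr h_incr mf mh fX fY hX hY disc.
(* The squared polynomial is the covariance of [(f + t h)(X)] and [(f + t h)(Y)]; the two factors
   are [r ^ 2] times the variance of the former, and the variance of the latter. *)
have [||k [kf kfh kh]] := @square_eq_mul_quadratic R
  (rcov P (f \o X) (f \o Y))
  (rcov P (f \o X) (h \o Y) + rcov P (h \o X) (f \o Y))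
  (rcov P (h \o X) (h \o Y))
  (r ^+ 2 * rcov P (f \o X) (f \o X))
  (r ^+ 2 * (2 * rcov P (f \o X) (h \o X)))
  (r ^+ 2 * rcov P (h \o X) (h \o X))
  (rcov P (f \o Y) (f \o Y)) (2 * rcov P (f \o Y) (h \o Y))
  (rcov P (h \o Y) (h \o Y)).
- move=> t t0; pose g x := f x + h x * t.
  have gE U : g \o U = (f \o U) \+ (t \o* (h \o U)) by [].
  have gU U : f \o U \in Lfun P 2%:E -> h \o U \in Lfun P 2%:E ->
      g \o U \in Lfun P 2%:E.
    by move=> fU hU; rewrite gE Lfun2D ?Lfun2Z.
  have := @IC_up_rcov X Y r g XYr.
  move=> /(_ _ _ (gU _ fX hX) (gU _ fY hY)) gXY.
  rewrite -rcovDZ// -gE gXY; last 2 first.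
  + by move=> x y xy; rewrite /g lerD ?ler_wpM2r ?f_incr ?h_incr// ltW.
  + by apply: measurable_funD => //; exact: measurable_funM.
  rewrite !exprMn !sqr_sqrtr ?rcov_ge0// !gE !rcovDZ//.
  rewrite ![rcov P (h \o _) (f \o _)]rcovC; ring.
- by rewrite exprMn; nra.
exists (k / r ^+ 2).
have kr z : r ^+ 2 * (k / r ^+ 2 * z) = k * z by field.
have r20 : r ^+ 2 != 0 by rewrite expf_neq0.
split; apply: (mulfI r20); rewrite kr//.
by apply: (@mulfI _ 2) => //; rewrite mulrCA kfh mulrCA.
Qed.

End increasing.

(** * Equality of tails from a nonzero correlation and three support points *)

Section three_point_support.
Context d (T : measurableType d) (R : realType) (P : probability T R).
Implicit Types (X Y : T -> R).

Lemma ae_exists_mem (Q : T -> Prop) (A : set T) : {ae P, forall t, Q t} ->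
  measurable A -> (0 < P A)%E -> exists2 t, A t & Q t.
Proof.
move=> [N [mN PN0 subN]] mA PA; apply: contrapT => noAQ.
have AN : A `<=` N by move=> t At; apply: subN => /= Qt; apply: noAQ; exists t.
by move: PA; rewrite ltNge -PN0 le_measure ?inE.
Qed.

Lemma tail_itv Y (a b : R) : measurable_fun setT Y -> a <= b ->
  P [set t | (a < Y t <= b)%R] = (tail P Y a - tail P Y b)%:E.
Proof.
move=> mY ab; have m c := measurable_tail c mY.
rewrite (_ : [set t | _] =
  (Y @^-1` `]a, +oo[%classic) `\` (Y @^-1` `]b, +oo[%classic)); last first.
  apply/seteqP; split => t /=; rewrite !in_itv/= !andbT.
    by move=> /andP[aY Yb]; split => //; apply/negP; rewrite -leNgt.
  by move=> [aY /negP]; rewrite -leNgt => ->; rewrite aY.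
rewrite measureD//; last by rewrite ltey_eq fin_num_measure.
rewrite setIidr ?EFinB ?fineK ?fin_num_measure//.
by move=> t /=; rewrite !in_itv/= !andbT; exact: le_lt_trans.
Qed.

Lemma Supp_tail Y (x e : R) : measurable_fun setT Y -> Supp P Y x -> 0 < e ->
  tail P Y (x + e) < tail P Y (x - e).
Proof.
move=> mY /(_ e) + e0 => /(_ e0).
by rewrite tail_itv ?lte_fin ?subr_gt0//; lra.
Qed.

Lemma card_gt2_sorted (S : set R) : card_gt2 S ->
  exists a b c, [/\ S a, S b, S c, a < b & b < c].
Proof.
move=> [a [b [c [Sa Sb Sc [ab ac bc]]]]].
move: ab ac bc; rewrite !neq_lt.
move=> /orP[] h1 /orP[] h2 /orP[] h3; try lra.
- by exists a, b, c.
- by exists a, c, b.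
- by exists c, a, b.
- by exists b, a, c.
- by exists b, c, a.
- by exists c, b, a.
Qed.

(** The thresholds surround the middle one of three support points, so that each of the three pieces
    they cut out of the line has positive mass. *)
Lemma card_gt2_Supp_tail Y : measurable_fun setT Y -> card_gt2 (Supp P Y) ->
  exists a b, [/\ a < b, 0 < tail P Y b, tail P Y b < tail P Y a &
    tail P Y a < 1].
Proof.
move=> mY /card_gt2_sorted[x [y [z [Sx Sy Sz xy yz]]]].
(* Half the smaller gap: the half-open windows of radius [e] around the three points are
   disjoint. *)
have [e [e0 exy eyz]] : exists e : R, [/\ 0 < e, x + e <= y - e & y + e <= z - e].
  have [le|le] := leP (y - x) (z - y).
    by exists ((y - x) / 2); split; lra.
  by exists ((z - y) / 2); split; lra.
exists (y - e), (y + e); split.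
- lra.
- apply: le_lt_trans (tail_ge0 P Y (z + e)) _.
  apply: lt_le_trans (Supp_tail mY Sz e0) _; exact: le_tail.
- exact: Supp_tail.
- apply: le_lt_trans (le_tail P mY exy) _.
  apply: lt_le_trans (Supp_tail mY Sx e0) _; exact: tail_le1.
Qed.

(** Equality in Cauchy-Schwarz would make [Y] almost surely an affine function of the indicator of
    [Y > b], hence constant where [Y <= b]. But both [Y <= a] and [a < Y <= b] have positive
    probability. *)
Lemma lt_rcov_id_ray Y (a b : R) : Y \in Lfun P 2%:E -> a < b ->
  0 < tail P Y b -> tail P Y b < tail P Y a -> tail P Y a < 1 ->
  rcov P Y (ray b \o Y) ^+ 2 < rcov P Y Y * rcov P (ray b \o Y) (ray b \o Y).
Proof.
move=> Y2 ab b0 tba a1; have mY := Lfun2_measurable Y2.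
have r2 := Lfun2_ray P b mY.
set C := rcov P Y (ray b \o Y); set V := rcov P (ray b \o Y) (ray b \o Y).
have V0 : 0 < V by rewrite /V rcov_ray// mulr_gt0// subr_gt0; lra.
rewrite ltNge; apply/negP => disc.
(* The coefficient [- C / V] minimises the variance of [Y + s * ray b(Y)] over [s]; the minimum is
   [(Var Y * V - C ^ 2) / V]. *)
have W2 : Y \+ (- C / V) \o* (ray b \o Y) \in Lfun P 2%:E.
  by rewrite Lfun2D// Lfun2Z.
have [c Yc] : exists c : R,
    {ae P, forall t, (Y \+ (- C / V) \o* (ray b \o Y)) t = c}.
  apply: (rcov_ae_cst0 W2); apply/eqP; rewrite eq_le rcov_ge0 andbT.
  rewrite rcovDZ// [rcov P (ray b \o _) Y]rcovC -/C -/V.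
  rewrite (_ : _ + _ = (rcov P Y Y * V - C ^+ 2) / V); last by field; lra.
  by rewrite ler_pdivrMr// mul0r subr_le0.
have YaE : [set t | Y t <= a] = ~` (Y @^-1` `]a, +oo[%classic).
  by apply/seteqP; split => t /=; rewrite in_itv/= andbT leNgt => /negP.
have [||t1 Yt1] := ae_exists_mem (A := [set t | Y t <= a]) Yc.
- by rewrite YaE; apply: measurableC; exact: measurable_tail.
- rewrite YaE probability_setC; last exact: measurable_tail.
  rewrite -(fineK (fin_num_measure P _ (measurable_tail a mY))) -EFinB.
  by rewrite lte_fin subr_gt0.
move=> /=; rewrite rayE ltNge (le_trans Yt1 (ltW ab))/= mul0r addr0 => Yt1c.
have [||t2 /=/andP[aY2 Y2b]] := ae_exists_mem (A := [set t | a < Y t <= b]) Yc.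
- rewrite (_ : [set t | _] = Y @^-1` `]a, b]%classic) //.
    by rewrite -[X in measurable X]setTI; exact: mY.
- by rewrite tail_itv ?ltW// lte_fin subr_gt0.
rewrite rayE ltNge Y2b/= mul0r addr0 => Yt2c.
by move: aY2; rewrite Yt2c -Yt1c ltNge Yt1.
Qed.

(** For two rays, proportionality becomes the three equations of [proportional_bernoulli_cov];
    [nondeg] excludes the factor [k = 0]. *)
Lemma IC_up_tail X Y (r a b : R) : IC_up P X Y r -> r != 0 ->
  measurable_fun setT X -> measurable_fun setT Y -> a < b ->
  0 < tail P Y b -> tail P Y b < tail P Y a -> tail P Y a < 1 ->
  rcov P (ray a \o X) (ray a \o X) != 0 \/ rcov P (ray b \o X) (ray b \o X) != 0 ->
  tail P X a = tail P Y a /\ tail P X b = tail P Y b.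
Proof.
move=> XYr r0 mX mY ab b0 tba a1 nondeg.
have [k [kaa kab kbb]] : exists k,
  [/\ rcov P (ray a \o X) (ray a \o X) = k * rcov P (ray a \o Y) (ray a \o Y),
    rcov P (ray a \o X) (ray b \o X) = k * rcov P (ray a \o Y) (ray b \o Y) &
    rcov P (ray b \o X) (ray b \o X) = k * rcov P (ray b \o Y) (ray b \o Y)].
  apply: (IC_up_proportional XYr r0); rewrite ?rcov_ray ?(ltW ab)//;
    try exact: homo_ray; try exact: measurable_ray; try exact: Lfun2_ray.
  rewrite -subr_gt0.
  set p := tail P Y a in a1 tba *; set q := tail P Y b in b0 tba *.
  (* The determinant of the covariance matrix of the two indicators is the product of the masses of
     [Y > b], [Y <= a] and [a < Y <= b]. *)
  rewrite (_ : _ - _ = q * (1 - p) * (p - q)); last by ring.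
  by rewrite !mulr_gt0 ?subr_gt0.
have k0 : k != 0.
  by apply/eqP => k0; move: nondeg; rewrite kaa kbb k0 !mul0r eqxx; case.
move: kaa kab kbb; rewrite !rcov_ray ?(ltW ab)// => kaa kab kbb.
exact: (proportional_bernoulli_cov kaa kab kbb).
Qed.

(** Tails are first matched at two thresholds [a < b]; any other [c] is then paired with whichever
    of them keeps the three masses positive. *)
Lemma IC_up_tail_eq X Y (r : R) : IC_up P X Y r -> r != 0 ->
  inL2 P X -> inL2 P Y -> card_gt2 (Supp P Y) ->
  forall c, tail P X c = tail P Y c.
Proof.
move=> XYr r0 /inL2P[X2 VX0] /inL2P[Y2 _] cardY.
have [mX mY] := (Lfun2_measurable X2, Lfun2_measurable Y2).
have [a [b [ab b0 tba a1]]] := card_gt2_Supp_tail mY cardY.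
have degE Z c : measurable_fun setT Z -> 0 < tail P Z c -> tail P Z c < 1 ->
    rcov P (ray c \o Z) (ray c \o Z) != 0.
  by move=> mZ c0 c1; rewrite rcov_ray// mulf_neq0//; lra.
have [Xa Xb] : tail P X a = tail P Y a /\ tail P X b = tail P Y b.
  (* Testing with the identity shows that [X] charges both sides of [b]. *)
  apply: (IC_up_tail XYr) => //; right.
  have [|||||||||k [kid _ kb]] := @IC_up_proportional _ _ _ P X Y r id (ray b) XYr r0;
    try exact: homo_ray; try exact: measurable_ray; try exact: Lfun2_ray.
  - by [].
  - exact: measurable_id.
  - exact: X2.
  - exact: Y2.
  - exact: (lt_rcov_id_ray Y2 ab).
  rewrite kb mulf_neq0//.
    by apply: contra_neq VX0 => k0; rewrite -[X]/(id \o X) kid k0 mul0r.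
  by apply: degE => //; lra.
(* Stated for a generic pair because it is used for [(X, Y)] and, by the symmetry [IC_upC], for
   [(Y, X)]. *)
have XYeq (U V : T -> R) : IC_up P U V r ->
    measurable_fun setT U -> measurable_fun setT V ->
    0 < tail P V b -> tail P V b < tail P V a -> tail P V a < 1 ->
    tail P U a = tail P V a -> tail P U b = tail P V b -> forall c,
    [\/ c < a /\ tail P V c < 1, b < c /\ 0 < tail P V c |
     [/\ a < c, c < b & tail P V c < tail P V a]] -> tail P U c = tail P V c.
  move=> UVr mU mV Vb0 Vba Va1 Ua Ub c.
  have dega : rcov P (ray a \o U) (ray a \o U) != 0 by apply: degE => //; lra.
  have degb : rcov P (ray b \o U) (ray b \o U) != 0 by apply: degE => //; lra.
  move=> [[ca c1]|[bc c0]|[ac cb cla]].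
  - have cb : c < b by exact: lt_trans ab.
    have tac := le_tail P mV (ltW ca).
    by have [] := IC_up_tail UVr r0 mU mV cb Vb0
      (lt_le_trans Vba tac) c1 (or_intror degb).
  - have ac : a < c by exact: lt_trans bc.
    have tcb := le_tail P mV (ltW bc).
    by have [] := IC_up_tail UVr r0 mU mV ac c0
      (le_lt_trans tcb Vba) Va1 (or_introl dega).
  - have tbc := le_tail P mV (ltW cb).
    by have [] := IC_up_tail UVr r0 mU mV ac
      (lt_le_trans Vb0 tbc) cla Va1 (or_introl dega).
have {}XYeq c : [\/ c < a /\ tail P Y c < 1, b < c /\ 0 < tail P Y c |
     [/\ a < c, c < b & tail P Y c < tail P Y a]] \/
    [\/ c < a /\ tail P X c < 1, b < c /\ 0 < tail P X c |
     [/\ a < c, c < b & tail P X c < tail P X a]] -> tail P X c = tail P Y c.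
  case=> [cY|cX]; first exact: XYeq cY.
  by apply/esym; apply: XYeq cX => //;
    [exact: IC_upC|rewrite Xb|rewrite Xa Xb|rewrite Xa].
have upper Z c : measurable_fun setT Z -> tail P Z c < 1 \/ tail P Z c = 1.
  by move=> mZ; have := tail_le1 P c mZ; rewrite le_eqVlt => /predU1P[];
    [right|left].
have lower Z c : 0 < tail P Z c \/ tail P Z c = 0.
  by have := tail_ge0 P Z c; rewrite le_eqVlt => /predU1P[]; [right|left].
(* If [c] is unusable for both variables, each tail at [c] takes the same extreme value: 1 below
   [a], 0 above [b], and the common tail at [a] in between. *)
move=> c; have [ca|ac|->//] := ltgtP c a.
  case: (upper Y c mY) => [Y1|Y1]; first by apply: XYeq; left; exact: Or31.
  case: (upper X c mX) => [X1|X1]; last by rewrite X1 Y1.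
  by apply: XYeq; right; exact: Or31.
have [cb|bc|->//] := ltgtP c b.
  have := le_tail P mY (ltW ac); rewrite le_eqVlt => /predU1P[Yc|Yc]; last first.
    by apply: XYeq; left; exact: Or33.
  have := le_tail P mX (ltW ac); rewrite le_eqVlt => /predU1P[Xc|Xc]; last first.
    by apply: XYeq; right; exact: Or33.
  by rewrite Yc Xc.
case: (lower Y c) => [Y0|Y0]; first by apply: XYeq; left; exact: Or32.
by case: (lower X c) => [X0|X0]; [apply: XYeq; right; exact: Or32|rewrite X0 Y0].
Qed.

End three_point_support.

(** * Joint and product laws on the plane, and their determination by products of upward closed
    sets *)

Section plane_laws.
Context d (T : measurableType d) (R : realType) (P : probability T R).
Implicit Types (U V : {mfun T >-> R}) (f h : R -> R).

Definition pair_mfun U V : {mfun T >-> (R * R)%type} :=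
  mfun_Sub (mem_set (measurable_fun_pair (@measurable_funPT _ _ _ _ U)
                                         (@measurable_funPT _ _ _ _ V))).

Let measurable_prod2 f h : measurable_fun setT f -> measurable_fun setT h ->
  measurable_fun setT (fun z : R * R => (f z.1 * h z.2)%:E).
Proof.
by move=> mf mh; apply/measurable_EFinP; apply: measurable_funM;
  exact: measurableT_comp.
Qed.

(** Together with [integral_product_law], this expresses a covariance as a difference of integrals
    of [f x * h y] against the joint law and the product of the marginals. *)
Lemma integral_joint U V f h :
  measurable_fun setT f -> measurable_fun setT h ->
  (forall x, 0 <= f x) -> (forall x, 0 <= h x) ->
  (\int[distribution P (pair_mfun U V)]_z (f z.1 * h z.2)%:E =
   'E_P[((f \o U) \* (h \o V))%R])%E.
Proof.
move=> mf mh f0 h0; rewrite ge0_integral_distribution.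
- by rewrite [in RHS]unlock.
- exact: measurable_prod2.
- by move=> z; rewrite lee_fin mulr_ge0.
Qed.

Lemma integral_product_law U V f h :
  measurable_fun setT f -> measurable_fun setT h ->
  (forall x, 0 <= f x) -> (forall x, 0 <= h x) ->
  (\int[distribution P U \x distribution P V]_z (f z.1 * h z.2)%:E =
   'E_P[(f \o U)%R] * 'E_P[(h \o V)%R])%E.
Proof.
move=> mf mh f0 h0.
have E (W : {mfun T >-> R}) (g : R -> R) : measurable_fun setT g ->
    (forall x, 0 <= g x) -> (\int[distribution P W]_x (g x)%:E = 'E_P[(g \o W)%R])%E.
  move=> mg g0; rewrite ge0_integral_distribution//; first by rewrite [in RHS]unlock.
    exact/measurable_EFinP.
rewrite fubini_tonelli1/=; first last.
- by move=> z; rewrite lee_fin mulr_ge0.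
- exact: measurable_prod2.
transitivity (\int[distribution P U]_x ((f x)%:E * 'E_P[(h \o V)%R]))%E.
  apply: eq_integral => x _; rewrite /fubini_F/=.
  under eq_integral do rewrite EFinM.
  rewrite ge0_integralZl ?E ?lee_fin//.
  - exact/measurable_EFinP.
  - by move=> y _; rewrite lee_fin.
rewrite ge0_integralZr ?E//.
- exact/measurable_EFinP.
- by move=> x _; rewrite lee_fin.
- by apply: expectation_ge0 => t; exact: h0.
Qed.

(* These are the upward closed sets; unlike the open rays, they include the
   whole line. *)
Definition upset : set (set R) :=
  [set A | measurable A /\ {homo (\1_A : R -> R) : x y / x <= y}].

Lemma measurable_upset : @measurable _ R = <<s upset >>.
Proof.
rewrite eqEsubset; split; last first.
  by apply: smallest_sub; [exact: sigma_algebra_measurable|move=> A []].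
rewrite [X in X `<=` _](RGenOInfty.measurableE R).
apply: smallest_sub; first exact: smallest_sigma_algebra.
move=> _ [x ->]; apply: sub_sigma_algebra; split => //; exact: homo_ray.
Qed.

Lemma measurable_upsetX : @measurable _ (R * R)%type =
  <<s [set A `*` B | A in upset & B in upset] >>.
Proof.
have upsetT : upset setT by split => // x y _; rewrite !indicE !in_setT.
rewrite eqEsubset; split; last first.
  apply: smallest_sub; first exact: sigma_algebra_measurable.
  by move=> _ [A [mA _] [B [mB _] <-]]; exact: measurableX.
apply: smallest_sub; first exact: smallest_sigma_algebra.
(* The product sigma-algebra is generated by preimages under the two projections; the preimage of an
   upward closed set is a rectangle whose other side is the whole line. *)
rewrite !measurable_upset subUset; split.
- rewrite -[X in X `<=` _]g_sigma_preimageE.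
  apply: smallest_sub; first exact: smallest_sigma_algebra.
  move=> _ [A uA <-]; apply: sub_sigma_algebra; exists A => //; exists setT => //.
  by apply/seteqP; split => -[x y] /= [].
- rewrite -[X in X `<=` _]g_sigma_preimageE.
  apply: smallest_sub; first exact: smallest_sigma_algebra.
  move=> _ [A uA <-]; apply: sub_sigma_algebra; exists setT => //.
  by exists A => //; apply/seteqP; split => -[x y] /= [].
Qed.

Lemma upsetI : setI_closed upset.
Proof.
move=> A B [mA hA] [mB hB]; split; first exact: measurableI.
move=> x y xy; rewrite indicI /= ler_pM//; [exact: hA|exact: hB].
Qed.

(** These rectangles are stable under intersection, generate the sigma-algebra and include the
    plane, so the uniqueness theorem for finite measures applies. *)
Lemma upset_measure_unique (m1 m2 : {measure set (R * R) -> \bar R}) :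
  (m1 setT < +oo)%E ->
  (forall A B, upset A -> upset B -> m1 (A `*` B) = m2 (A `*` B)) ->
  forall A, measurable A -> m1 A = m2 A.
Proof.
move=> m1oo m12 A mA.
have upsetT : upset setT by split => // x y _; rewrite !indicE !in_setT.
apply: (measure_unique [set A `*` B | A in upset & B in upset] (fun=> setT)) => //.
- exact: measurable_upsetX.
- move=> _ _ [A1 uA1 [B1 uB1 <-]] [A2 uA2 [B2 uB2 <-]].
  by rewrite -setXI; exists (A1 `&` A2); [exact: upsetI|
    exists (B1 `&` B2) => //; exact: upsetI].
- by move=> _; exists setT => //; exists setT => //; rewrite setXTT.
- by rewrite bigcup_const.
- by move=> _ [A1 uA1 [B1 uB1 <-]]; exact: m12.
Qed.

End plane_laws.

(** * Passage from increasing to measurable test functions by polarisation *)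

Section increasing_to_measurable.
Context d (T : measurableType d) (R : realType) (P : probability T R).
Variables (X Y : {mfun T >-> R}) (r : R).
Implicit Types f g h : R -> R.

Let sqint f := [/\ measurable_fun setT f, f \o X \in Lfun P 2%:E &
  f \o Y \in Lfun P 2%:E].

Let sqintD f h : sqint f -> sqint h -> sqint (f \+ h).
Proof.
move=> [mf fX fY] [mh hX hY]; split; first exact: measurable_funD.
  exact: (Lfun2D fX hX).
exact: (Lfun2D fY hY).
Qed.

(** [Q g = 0] is the correlation condition at [g] when [r = 0] or when [g(X)] and [g(Y)] have equal
    variances. *)
Let Q g := rcov P (g \o X) (g \o Y) - r * rcov P (g \o X) (g \o X).

(** The symmetric bilinear form polarising [Q], normalised so that [S f f = 2 * Q f]. *)
Let S f h := rcov P (f \o X) (h \o Y) + rcov P (h \o X) (f \o Y)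
  - 2 * r * rcov P (f \o X) (h \o X).

Let QD f h : sqint f -> sqint h -> Q (f \+ h) = Q f + S f h + Q h.
Proof.
move=> [mf fX fY] [mh hX hY]; rewrite /Q /S.
have E U : (f \+ h) \o U = (f \o U) \+ (1 \o* (h \o U)).
  by apply/funext => t; rewrite /= mulr1.
by rewrite !E !rcovDZ// [rcov P (h \o X) (f \o X)]rcovC; ring.
Qed.

Let nu : {mfun T >-> R} -> {mfun T >-> R} -> {measure set (R * R) -> \bar R} :=
  fun U V => distribution P (pair_mfun U V).

Let prodl : {mfun T >-> R} -> {mfun T >-> R} -> {measure set (R * R) -> \bar R} :=
  fun U V => (distribution P U \x distribution P V)%E.

Let mix (m1 m2 m3 m4 : {measure set (R * R) -> \bar R}) (a b : {nonneg R}) :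
    {measure set (R * R) -> \bar R} :=
  measure_add (measure_add m1 m2) (measure_add (mscale a m3) (mscale b m4)).

Let mixE m1 m2 m3 m4 a b A :
  (mix m1 m2 m3 m4 a b A = m1 A + m2 A + (a%:num%:E * m3 A + b%:num%:E * m4 A))%E.
Proof. by rewrite [LHS]measure_addE; congr (_ + _)%E; exact: measure_addE. Qed.

Let integral_mix (m1 m2 m3 m4 : {measure set (R * R) -> \bar R}) (a b : {nonneg R})
    (F : R * R -> \bar R) : measurable_fun setT F -> (forall z, 0 <= F z)%E ->
  (\int[mix m1 m2 m3 m4 a b]_z F z = \int[m1]_z F z + \int[m2]_z F z +
    (a%:num%:E * \int[m3]_z F z + b%:num%:E * \int[m4]_z F z))%E.
Proof.
move=> mF F0.
by rewrite !ge0_integral_measure_add// !ge0_integral_mscale.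
Qed.

Variables a b : {nonneg R}.
Hypothesis abr : 2 * r = a%:num - b%:num.

(* Polarised, the identity [Q = 0] says that these two measures agree on
   products of upward closed sets; [2 * r] is written [a - b] so that all
   weights are nonnegative. *)
Let mu1 := mix (nu X Y) (nu Y X) (nu X X) (prodl X X) b a.
Let mu2 := mix (prodl X Y) (prodl Y X) (nu X X) (prodl X X) a b.

Let integral_eqP f h : sqint f -> sqint h ->
  (forall x, 0 <= f x) -> (forall x, 0 <= h x) ->
  (\int[mu1]_z (f z.1 * h z.2)%:E = \int[mu2]_z (f z.1 * h z.2)%:E)%E <->
  S f h = 0.
Proof.
move=> [mf fX fY] [mh hX hY] f0 h0.
have mF : measurable_fun setT (fun z : R * R => (f z.1 * h z.2)%:E).
  by apply/measurable_EFinP; apply: measurable_funM; exact: measurableT_comp.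
have F0 (z : R * R) : (0 <= (f z.1 * h z.2)%:E)%E by rewrite lee_fin mulr_ge0.
rewrite !integral_mix// !integral_joint// !integral_product_law// /S !rcovE//.
rewrite (_ : (h \o X) \* (f \o Y) = (f \o Y) \* (h \o X)); last first.
  by apply/funext => t /=; rewrite mulrC.
have fin1 U : U \in Lfun P 2%:E -> ('E_P[U] = (fine 'E_P[U])%:E)%E.
  by move=> U2; rewrite fineK// expectation_fin_num// Lfun2_1.
have fin2 U V : U \in Lfun P 2%:E -> V \in Lfun P 2%:E ->
    ('E_P[U \* V] = (fine 'E_P[U \* V])%:E)%E.
  by move=> U2 V2; rewrite fineK// expectation_fin_num// Lfun2_mul_Lfun1.
(* All expectations are finite, so terms can be moved across the equality as real numbers. *)
rewrite (fin1 _ fX) (fin1 _ fY) (fin1 _ hX) (fin1 _ hY).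
rewrite (fin2 _ _ fX hX) (fin2 _ _ fX hY) (fin2 _ _ fY hX) /=.
rewrite -!EFinM -!EFinD abr.
by split => [[/eqP]|/eqP e]; [rewrite -subr_eq0 => /eqP e; rewrite -[RHS]e; ring|
  congr EFin; apply/eqP; rewrite -subr_eq0 -(eqP e); apply/eqP; ring].
Qed.

Hypothesis Q0 : forall g, {homo g : x y / x <= y} -> sqint g -> Q g = 0.

Let mu_eq A : measurable A -> mu1 A = mu2 A.
Proof.
apply: upset_measure_unique.
  have prod1 U V : prodl U V setT = 1%E.
    rewrite -setXTT /prodl [LHS]product_measure1E//.
    have law1 (W : {mfun T >-> R}) : distribution P W setT = 1%E.
      exact: (probability_setT (distribution P W)).
    by rewrite -[RHS]mule1; congr (_ * _)%E; exact: law1.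
  have nu1 U V : nu U V setT = 1%E.
    exact: (probability_setT (distribution P (pair_mfun U V))).
  rewrite mixE prod1 !nu1.
  by rewrite !mule1 -!EFinD ltry.
move=> {}A B [mA hA] [mB hB].
have sq C : measurable C -> sqint \1_C.
  move=> mC; have comp (U : {mfun T >-> R}) : \1_C \o U \in Lfun P 2%:E.
    rewrite (_ : _ \o _ = \1_(U @^-1` C)); last first.
      by apply/funext => t; rewrite /= !indicE.
    by rewrite Lfun2_indic// -[X in measurable X]setTI; exact: measurable_funPT.
  by split => //; exact: measurable_indic.
(* [Q] vanishes at both indicators and at their sum, all three being increasing, which leaves only
   the cross term. *)
have : S \1_A \1_B = 0.
  have := QD (sq _ mA) (sq _ mB).
  rewrite (Q0 hA (sq _ mA)) (Q0 hB (sq _ mB)) Q0; last 2 first.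
  - by move=> x y xy; exact: lerD (hA _ _ xy) (hB _ _ xy).
  - exact: sqintD (sq _ mA) (sq _ mB).
  by rewrite add0r addr0.
move/(integral_eqP (sq _ mA) (sq _ mB)) => AB.
have E (m : {measure set (R * R) -> \bar R}) :
    m (A `*` B) = (\int[m]_z (\1_A z.1 * \1_B z.2)%:E)%E.
  rewrite -[A `*` B in LHS]setIT -integral_indic//; last exact: measurableX.
  by apply: eq_integral => -[x y] _; rewrite !indicE in_setX -natrM mulnb.
by rewrite !E; apply: AB => x; rewrite indicE.
Qed.

Let nneg_S f h : sqint f -> sqint h -> (forall x, 0 <= f x) ->
  (forall x, 0 <= h x) -> S f h = 0.
Proof.
move=> sf sh f0 h0; apply/integral_eqP => //.
apply: eq_measure_integral => A mA _; exact: mu_eq.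
Qed.

(** A signed [g] is reduced to the nonnegative functions [h = |g|] and [f = g + |g|]: bilinearity
    gives [S g h = S f h - S h h = 0], and then [Q f = Q g + S g h + Q h] gives [Q g = 0]. *)
Lemma rcov_measurable g : sqint g ->
  rcov P (g \o X) (g \o Y) = r * rcov P (g \o X) (g \o X).
Proof.
move=> sg; pose h := Num.norm \o g; pose f := g \+ h.
have sh : sqint h.
  by case: sg => mg gX gY; split; [exact: measurableT_comp|exact: Lfun2_norm..].
have sf : sqint f by exact: sqintD.
have f0 x : 0 <= f x by rewrite /f -lerBlDr sub0r lerNnormlW.
have h0 x : 0 <= h x by exact: normr_ge0.
have Sg : S g h = 0.
  have : S f h = S g h + S h h.
    have [[_ gX gY] [_ hX hY]] := (sg, sh).
    have fE U : f \o U = (g \o U) \+ (h \o U) by [].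
    rewrite /S !fE (rcovDl gX hX hY) (rcovDl gX hX hX).
    rewrite ![rcov P (h \o X) (_ \+ _)]rcovC (rcovDl gY hY hX).
    by rewrite !(rcovC _ (h \o X)); ring.
  by rewrite (nneg_S sf sh f0 h0) (nneg_S sh sh h0 h0) addr0 => ->.
have diag k : S k k = 2 * Q k by rewrite /S /Q; ring.
have Qnneg k : sqint k -> (forall x, 0 <= k x) -> Q k = 0.
  by move=> sk k0; apply: (@mulfI _ 2) => //; rewrite -diag nneg_S// mulr0.
have := QD sg sh; rewrite -/f Sg (Qnneg _ sf)// (Qnneg _ sh)// !addr0 => /esym.
by move=> /eqP; rewrite subr_eq0 => /eqP.
Qed.

End increasing_to_measurable.

(** * Equality in law, and the equivalence when [r = 0] or the laws agree *)

Section same_law.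
Context d (T : measurableType d) (R : realType) (P : probability T R).
Implicit Types X Y : {mfun T >-> R}.

(** Open rays are stable under intersection and generate the Borel sets; the rays from [- n] exhaust
    the line. *)
Lemma tail_same_distribution X Y :
  (forall c, tail P X c = tail P Y c) -> same_distribution P X Y.
Proof.
move=> tXY; apply: (measure_unique (@RGenOInfty.G R)
  (fun n => `]- n%:R, +oo[%classic) _ _ _ _ (distribution P X) (distribution P Y)).
- exact: RGenOInfty.measurableE.
- move=> _ _ [x ->] [y ->]; exists (Num.max x y).
  by apply/seteqP; split => z /=; rewrite !in_itv/= !andbT gt_max => /andP.
- by move=> n; exists (- n%:R).
- rewrite -subTset => x _; exists (Num.bound `|x|) => //=.
  rewrite in_itv/= andbT ltrNl.
  by apply: le_lt_trans (archi_boundP (normr_ge0 x)); rewrite -normrN ler_norm.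
- move=> _ [c ->]; rewrite /distribution /pushforward.
  have fin (Z : {mfun T >-> R}) :
      (tail P Z c)%:E = P (Z @^-1` `]c, +oo[%classic).
    by rewrite fineK// fin_num_measure//; exact: measurable_tail.
  by rewrite -[LHS]fin -[RHS]fin tXY.
- by move=> n; rewrite ltey_eq fin_num_measure.
Qed.

Lemma same_distribution_expectation X Y (f : R -> R) :
  same_distribution P X Y -> measurable_fun setT f ->
  f \o X \in Lfun P 1 -> f \o Y \in Lfun P 1 ->
  ('E_P[(f \o X)%R] = 'E_P[(f \o Y)%R])%E.
Proof.
move=> XY mf /Lfun1_integrable fX /Lfun1_integrable fY; rewrite unlock.
have mEf : measurable_fun setT (EFin \o f) by exact/measurable_EFinP.
rewrite -[LHS](integral_distribution mEf fX) -[RHS](integral_distribution mEf fY).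
by apply: eq_measure_integral => A mA _; exact: XY.
Qed.

Lemma same_distribution_rcov X Y (g : R -> R) :
  same_distribution P X Y -> measurable_fun setT g ->
  g \o X \in Lfun P 2%:E -> g \o Y \in Lfun P 2%:E ->
  rcov P (g \o X) (g \o X) = rcov P (g \o Y) (g \o Y).
Proof.
move=> XY mg gX gY; rewrite !rcovE//.
rewrite (same_distribution_expectation XY mg) ?Lfun2_1//.
congr (fine _ - _).
apply: (@same_distribution_expectation X Y (fun x => g x * g x)) => //.
- exact: measurable_funM.
- exact: Lfun2_mul_Lfun1.
- exact: Lfun2_mul_Lfun1.
Qed.

Lemma IC_up_IC X Y (r : R) : r = 0 \/ same_distribution P X Y ->
  IC_up P X Y r -> IC P X Y r.
Proof.
move=> r0_law XYr; split=> [|g [mg /inL2P[gX VX0] /inL2P[gY VY0]]].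
  by case: XYr.
have cov_g : rcov P (g \o X) (g \o Y) = r * rcov P (g \o X) (g \o X).
  (* The weights are the positive and negative parts of [2 * r]. *)
  have a0 : 0 <= Num.max (2 * r) 0 by rewrite le_max lexx orbT.
  have b0 : 0 <= Num.max (- (2 * r)) 0 by rewrite le_max lexx orbT.
  apply: (rcov_measurable (a := NngNum a0) (b := NngNum b0)) => //=.
    by have [h|h] := leP 0 (2 * r); have [h'|h'] := leP (- (2 * r)) 0; lra.

  (* When the laws agree, the two standard deviations coincide and their product is the variance of
     [h(X)]. *)
  move=> h h_incr [mh hX hY]; rewrite (IC_up_rcov XYr)//.
  case: r0_law => [->|law]; first by rewrite !mul0r subrr.
  rewrite -(same_distribution_rcov law mh hX hY).
  by rewrite -expr2 sqr_sqrtr ?rcov_ge0// subrr.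
rewrite corrE cov_g; case: r0_law => [->|law]; first by rewrite !mul0r.
rewrite -(same_distribution_rcov law mg gX gY).
by rewrite -expr2 sqr_sqrtr ?rcov_ge0// mulfK.
Qed.

End same_law.

Theorem theorem5 (d : measure_display) (T : measurableType d) (R : realType)
    (P : probability T R) (X Y : T -> R) :
  atomless P -> inL2 P X -> inL2 P Y ->
  (corr P X Y = 0 \/ same_distribution P X Y \/
   (~ same_distribution P X Y /\ card_gt2 (Supp P Y))) ->
  (IC P X Y (corr P X Y) <-> IC_up P X Y (corr P X Y)) /\
  (~ same_distribution P X Y -> card_gt2 (Supp P Y) ->
     IC_up P X Y (corr P X Y) -> corr P X Y = 0).
Proof.
move=> _ X2 Y2 H.
pose X' : {mfun T >-> R} := mfun_Sub (mem_set (Lfun2_measurable (proj1 X2))).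
pose Y' : {mfun T >-> R} := mfun_Sub (mem_set (Lfun2_measurable (proj1 Y2))).
(* A nonzero correlation would give equal tails, hence equal laws. *)
have corr0 : ~ same_distribution P X Y -> card_gt2 (Supp P Y) ->
    IC_up P X Y (corr P X Y) -> corr P X Y = 0.
  move=> law cardY XYr; apply/eqP; apply: contra_notT law => r0.
  apply: (@tail_same_distribution _ _ _ P X' Y').
  exact: IC_up_tail_eq XYr r0 X2 Y2 cardY.
split=> //; split=> [[XYr ICg]|XYr]; first by split=> // g _; exact: ICg.
apply: (@IC_up_IC _ _ _ P X' Y') => //.
(* With different laws and three support points, [corr0] reduces the claim to zero correlation. *)
by case: H => [|[|[law cardY]]]; [left|right|left; exact: corr0].
Qed.
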